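(* In the perfect channel-state-information case, i.e. when the precoder is $\mathbf V_L=$ the matrix of the first $S$ columns of $\mathbf V$, the bit metrics of the zero-forcing (ZF) receiver are equal to those of the optimum BICMB receiver: for every received vector $\mathbf y_k\in\mathbb{C}^M$, every stream $s\in\{1,\dots,S\}$, every bit position $i\in\{1,\dots,m\}$ and every bit value $b\in\{0,1\}$, $$\min_{x\in\chi_b^i}\frac{|\hat r_{k,s}-x|^2}{\|\mathbf g_s\|^2}\;=\;\min_{x\in\chi_b^i}|r'_{k,s}-\lambda_s x|^2 ,$$ where the left side is the ZF bit metric and the right side is the BICMB bit metric, as defined in the context.
   Context: Let $\mathbf H\in\mathbb{C}^{M\times N}$ have singular value decomposition $\mathbf H=\mathbf U\mathbf\Sigma\mathbf V^H$, with $\mathbf U\in\mathbb C^{M\times M}$, $\mathbf V\in\mathbb C^{N\times N}$ unitary and singular values $\lambda_1\ge\lambda_2\ge\cdots\ge 0$ on the diagonal of $\mathbf\Sigma$. Let $1\le S\le\min(N,M)$ be the number of streams and assume $\lambda_S>0$. The signal set $\chi\subseteq\mathbb C$ is finite with $|\chi|=2^m$ and is equipped with a bijective binary labeling $\{0,1\}^m\to\chi$; $\chi_b^i\subseteq\chi$ is the subset of signals whose label has value $b\in\{0,1\}$ in position $i$. The received vector at time $k$ is $\mathbf y_k=\mathbf H\mathbf V_L\mathbf x_k+\mathbf n_k\in\mathbb C^M$, with $\mathbf x_k\in\chi^S$ the transmitted vector and $\mathbf n_k\in\mathbb{C}^M$ noise. BICMB (bit-interleaved coded multiple beamforming) receiver: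 the detector is $\mathbf U^H$, and $r'_{k,s}$ is the $s$-th entry of $\mathbf U^H\mathbf y_k$, $s=1,\dots,S$; its bit metric is $\min_{x\in\chi_b^i}|r'_{k,s}-\lambda_s x|^2$. ZF receiver: the detector is $\mathbf G=(\mathbf H\mathbf V_L)^\dagger=[(\mathbf H\mathbf V_L)^H(\mathbf H\mathbf V_L)]^{-1}(\mathbf H\mathbf V_L)^H$, $\hat r_{k,s}$ is the $s$-th entry of $\mathbf G\mathbf y_k$, and $\mathbf g_s$ is the $s$-th column of $\mathbf G^T$ with Euclidean norm $\|\mathbf g_s\|$; its bit metric is $\min_{x\in\chi_b^i}|\hat r_{k,s}-x|^2/\|\mathbf g_s\|^2$. *)

(* Defs.v *)
From HB Require Import structures.
From mathcomp Require Import all_boot all_order all_algebra.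
From mathcomp Require Import spectral.
From mathcomp Require Import finmap complex reals.

Set Implicit Arguments.
Unset Strict Implicit.
Unset Printing Implicit Defensive.

Import Order.TTheory GRing.Theory Num.Theory.
Local Open Scope ring_scope.
Local Open Scope sesquilinear_scope.

Section Definitions.
Variable R : realType.
Local Notation C := R[i].

(* The norm `|z| of R[i] takes values in R[i] itself; [cmod] is the same
   modulus as an element of R, so that metrics are compared in R. *)
Definition cmod (z : C) : R := complex.Re `|z|.

Definition euclidean_norm n (v : 'cV[C]_n) : R :=
  Num.sqrt (\sum_i cmod (v i 0) ^+ 2).

(* The minimum over a finite nonempty set; the unit of the iterated minimum is
   the value at an element of A, so it is attained by [fset_minP] below. *)
Definition fset_min (A : {fset C}) (f : C -> R) : R :=
  \big[Num.min/f (head 0 A)]_(x <- A) f x.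

Lemma fset_minP (A : {fset C}) (f : C -> R) :
  A != fset0 ->
  (exists2 x, x \in A & fset_min A f = f x) /\
  (forall x, x \in A -> fset_min A f <= f x).
Proof.
move=> A0; have hA : head 0 A \in A.
  rewrite -[_ \in A]/(head 0 A \in enum_fset A).
  move: A0; rewrite -cardfs_gt0 /=.
  by case: (enum_fset A) => //= a r _; rewrite mem_head.
split; last first.
  move=> x xA; rewrite /fset_min.
  have: x \in enum_fset A by [].
  elim: (enum_fset A) (f _) => //= a s IH d; rewrite inE big_cons ge_min.
  by case/predU1P => [<-|/IH ->]; rewrite ?lexx ?orbT.
rewrite /fset_min big_seq.
apply: (big_ind (fun v => exists2 x, x \in A & v = f x)).
- by exists (head 0 A).
- move=> u v [x xA ->] [y yA ->]; rewrite /Num.min.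
  by case: ifP => _; [exists x | exists y].
- by move=> x xA; exists x.
Qed.

(* Indices are shifted to start at 0: lam k is the (k+1)-st singular value. *)
Definition sigma_mx M N (lam : 'I_(minn M N) -> R) : 'M[C]_(M, N) :=
  \matrix_(i, j) \sum_(k < minn M N | (k == i :> nat) && (k == j :> nat))
    ((lam k)%:C)%C.

Definition is_svd M N (H : 'M[C]_(M, N))
    (U : 'M[C]_M) (lam : 'I_(minn M N) -> R) (V : 'M[C]_N) : Prop :=
  [/\ U \is unitarymx, V \is unitarymx,
      (forall k, 0 <= lam k),
      (forall k l : 'I_(minn M N), (k <= l)%N -> lam l <= lam k)
    & H = U *m sigma_mx lam *m V ^t*].

Definition first_cols N (V : 'M[C]_N) S (hS : (S <= N)%N) : 'M[C]_(N, S) :=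
  colsub (widen_ord hS) V.

Definition zf_detector M S (A : 'M[C]_(M, S)) : 'M[C]_(S, M) :=
  invmx (A ^t* *m A) *m A ^t*.

Section SignalSet.
Variables (m : nat) (chi : {fset C}) (lab : m.-tuple bool -> chi).

Definition signal_subset (i : 'I_m) (b : bool) : {fset C} :=
  [fset fsval (lab c) | c : m.-tuple bool & tnth c i == b]%fset.

Lemma signal_subset_neq0 i b : signal_subset i b != fset0.
Proof.
apply/fset0Pn; exists (fsval (lab [tuple of nseq m b])).
by apply/imfsetP; exists [tuple of nseq m b] => //=; rewrite inE (tnth_nth b) nth_nseq ltn_ord.
Qed.

Definition bicmb_metric M N (U : 'M[C]_M) (lam : 'I_(minn M N) -> R)
    S (hS : (S <= minn M N)%N) (y : 'cV[C]_M)
    (s : 'I_S) (i : 'I_m) (b : bool) : R :=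
  let r := (U ^t* *m y) (widen_ord (leq_trans hS (geq_minl M N)) s) 0 in
  fset_min (signal_subset i b)
    (fun x => cmod (r - ((lam (widen_ord hS s))%:C)%C * x) ^+ 2).

Definition zf_metric M N (H : 'M[C]_(M, N)) S (VL : 'M[C]_(N, S))
    (y : 'cV[C]_M) (s : 'I_S) (i : 'I_m) (b : bool) : R :=
  let G := zf_detector (H *m VL) in
  let r := (G *m y) s 0 in
  let g := col s G^T in
  fset_min (signal_subset i b)
    (fun x => cmod (r - x) ^+ 2 / euclidean_norm g ^+ 2).

End SignalSet.
End Definitions.

(* Main.v *)
(** Write [Q] for the first [S] columns of [U] and [D] for the diagonal matrix
of the first [S] singular values. With perfect channel knowledge [H V_L = Q D],
where [Q] has orthonormal columns, so the pseudo-inverse is [D^-1 Q^H]. Hence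
the ZF statistic is the BICMB statistic divided by [lambda_s], and
[||g_s|| = 1 / lambda_s]; the two metrics then agree symbol by symbol. *)

Require Import Defs.
From HB Require Import structures.
From mathcomp Require Import all_boot all_order all_algebra.
From mathcomp Require Import spectral.
From mathcomp Require Import finmap complex reals.

Set Implicit Arguments.
Unset Strict Implicit.
Unset Printing Implicit Defensive.

Import Order.TTheory GRing.Theory Num.Theory.
Local Open Scope ring_scope.

Section ZeroForcing.
Local Open Scope sesquilinear_scope.
Variable R : realType.
Local Notation C := R[i].

(** Bridge used below: an identity between moduli in [R] is proved after embedding in [R[i]], where
    the norm lemmas apply. *)
Lemma cmodE (z : C) : ((cmod z)%:C)%C = `|z|.
Proof. by rewrite /cmod normc_def. Qed.

Lemma cmodM : {morph @cmod R : z w / z * w}.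
Proof.
by move=> z w; apply: (@complexI R); rewrite rmorphM /= !cmodE normrM.
Qed.

Lemma cmod_real (a : R) : cmod (a%:C)%C = `|a|.
Proof.
apply: (@complexI R).
by rewrite cmodE normc_def /= expr0n addr0 sqrtr_sqr.
Qed.

Lemma cmod_conj (z : C) : cmod z^* = cmod z.
Proof. by apply: (@complexI R); rewrite !cmodE norm_conjC. Qed.

Lemma euclidean_norm_sqr n (v : 'cV[C]_n) :
  euclidean_norm v ^+ 2 = \sum_i cmod (v i 0) ^+ 2.
Proof. by rewrite sqr_sqrtr // sumr_ge0 // => i _; rewrite sqr_ge0. Qed.

(** The seed of the iterated minimum depends on the function too, so it is rewritten along with the
    terms. *)
Lemma eq_fset_min (A : {fset C}) (f g : C -> R) :
  f =1 g -> fset_min A f = fset_min A g.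
Proof. by move=> fg; rewrite /fset_min fg; apply: eq_bigr => x _. Qed.

Definition real_diag n (d : 'I_n -> R) : 'M[C]_n :=
  diag_mx (\row_j ((d j)%:C)%C).

Lemma real_diag_adj n (d : 'I_n -> R) : (real_diag d) ^t* = real_diag d.
Proof.
rewrite /real_diag tr_diag_mx map_diag_mx; congr diag_mx.
by apply/rowP => j; rewrite !mxE; apply: conj_Creal; rewrite complex_real.
Qed.

Lemma real_diag_inv n (d : 'I_n -> R) : (forall j, d j != 0) ->
  real_diag (fun j => (d j)^-1) *m real_diag d = 1%:M.
Proof.
move=> d0; rewrite /real_diag mulmx_diag -diag_const_mx; congr diag_mx.
by apply/rowP => j; rewrite !mxE -rmorphM /= mulVf.
Qed.

(** As $Q^H Q = 1$ and $D$ is self-adjoint, the Gram matrix of $QD$ is $D^2$; one factor of $D^{-2}$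
    then cancels the $D$ in $(QD)^H = D Q^H$. *)
Lemma zf_detector_isometry_diag M n (Q : 'M[C]_(M, n)) (d : 'I_n -> R) :
  Q ^t* *m Q = 1%:M -> (forall j, d j != 0) ->
  zf_detector (Q *m real_diag d) = real_diag (fun j => (d j)^-1) *m Q ^t*.
Proof.
move=> QQ d0; have VD := real_diag_inv d0.
have [_ Du] := mulmx1_unit VD.
rewrite /zf_detector trmx_mul map_mxM real_diag_adj.
rewrite [X in invmx X]mulmxA -[X in invmx (X *m _)]mulmxA QQ mulmx1.
have -> : invmx (real_diag d *m real_diag d) =
    real_diag (fun j => (d j)^-1) *m real_diag (fun j => (d j)^-1).
  have DDu : real_diag d *m real_diag d \in unitmx by rewrite unitmx_mul Du.
  rewrite -[LHS]mul1mx; apply: (canLR (mulmxK DDu)).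
  by rewrite -mulmxA (mulmxA _ (real_diag d)) VD mul1mx VD.
by rewrite -mulmxA (mulmxA _ (real_diag d)) VD mul1mx.
Qed.

Lemma unitary_colsub n k (U : 'M[C]_n) (f : 'I_k -> 'I_n) :
  U \is unitarymx -> injective f -> (colsub f U) ^t* *m colsub f U = 1%:M.
Proof.
move=> /unitarymxP/mulmx1C UU finj; apply/matrixP => i j.
have := congr1 (fun A : 'M_n => A (f i) (f j)) UU.
rewrite !mxE (inj_eq finj) => <-.
by apply: eq_bigr => l _; rewrite !mxE.
Qed.

(** $V^H V = 1$ reduces $H V_L$ to the first $S$ columns of $U\Sigma$, and column $s$ of $\Sigma$
    has its only possibly nonzero entry in row $s$. *)
Lemma svd_mul_first_cols M N (H : 'M[C]_(M, N)) (U : 'M[C]_M)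
    (lam : 'I_(minn M N) -> R) (V : 'M[C]_N) S (hS : (S <= minn M N)%N) :
  is_svd H U lam V ->
  H *m first_cols V (leq_trans hS (geq_minr M N)) =
  colsub (widen_ord (leq_trans hS (geq_minl M N))) U
    *m real_diag (fun s => lam (widen_ord hS s)).
Proof.
case=> _ /unitarymxP/mulmx1C VV _ _ ->.
rewrite /first_cols mulmx_colsub -(mulmxA _ _ V) VV mulmx1.
apply/matrixP => i s; rewrite mul_mx_diag !mxE.
set p := widen_ord (leq_trans hS (geq_minl M N)) s.
rewrite (bigD1 p) //= [X in _ + X]big1 ?addr0.
  rewrite !mxE (big_pred1 (widen_ord hS s)) // => k /=.
  by rewrite andbb -val_eqE.
move=> j jNs; rewrite !mxE big1 ?mulr0 // => k /andP[/eqP kj /eqP ks].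
by case/eqP: jNs; apply: val_inj; rewrite /= -kj ks.
Qed.

Lemma unitary_col_cmod n (U : 'M[C]_n) j :
  U \is unitarymx -> \sum_i cmod (U i j) ^+ 2 = 1.
Proof.
move=> /unitarymxP/mulmx1C UU.
(* The squared norm of column $j$ is the diagonal entry $j$ of $U^H U$. *)
have := congr1 (fun A : 'M_n => A j j) UU; rewrite !mxE eqxx => U1.
apply: (@complexI R); rewrite rmorph_sum /= rmorph1 -[RHS]U1.
by apply: eq_bigr => i _; rewrite rmorphXn /= cmodE !mxE normCK mulrC.
Qed.

End ZeroForcing.

Theorem mainTheorem2 (R : realType) (M N S m : nat)
  (H : 'M[R[i]]_(M, N))
  (U : 'M[R[i]]_M) (lam : 'I_(minn M N) -> R) (V : 'M[R[i]]_N)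
  (hsvd : is_svd H U lam V)
  (hS0 : (1 <= S)%N) (hS : (S <= minn M N)%N)
  (hlam : forall k : 'I_(minn M N), k.+1 = S -> 0 < lam k)
  (chi : {fset R[i]}) (hchi : #|` chi| = (2 ^ m)%N)
  (lab : m.-tuple bool -> chi) (hlab : bijective lab)
  (VL : 'M[R[i]]_(N, S))
  (hVL : VL = first_cols V (leq_trans hS (geq_minr M N)))
  (y : 'cV[R[i]]_M) (s : 'I_S) (i : 'I_m) (b : bool) :
  zf_metric lab H VL y s i b = bicmb_metric lab U lam hS y s i b.
Proof.
case: (hsvd) => Uu _ _ lam_decr _.
(* Positivity of $\lambda_S$, at index [S.-1], spreads to all earlier singular values by
   monotonicity. *)
have lam_gt0 t : 0 < lam (widen_ord hS t).
  have lt_last : (S.-1 < minn M N)%N by rewrite prednK.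
  apply: (lt_le_trans (hlam (Ordinal lt_last) (prednK hS0))).
  by apply: lam_decr; rewrite /= -ltnS prednK.
set p := widen_ord (leq_trans hS (geq_minl M N)).
have p_inj : injective p by move=> a c /(congr1 val) eq_ac; apply: val_inj.
rewrite /zf_metric /bicmb_metric hVL (svd_mul_first_cols hS hsvd) -/p.
rewrite zf_detector_isometry_diag ?unitary_colsub //; last first.
  by move=> t; rewrite gt_eqF.
set l := lam _; have l_gt0 : 0 < l by exact: lam_gt0.
set G := real_diag _ *m _.
have GE k : G s k = ((l^-1)%:C)%C * (U k (p s))^*.
  by rewrite /G mul_diag_mx !mxE.
clearbody G.
have -> : euclidean_norm (col s G^T) ^+ 2 = l^-1 ^+ 2.
  (* The factor 1 is expanded as the squared norm of column [p s] of [U], so that both sums match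
     term by term. *)
  rewrite euclidean_norm_sqr -[RHS]mulr1 -(unitary_col_cmod (p s) Uu) mulr_sumr.
  apply: eq_bigr => k _.
  by rewrite !mxE GE cmodM cmod_real cmod_conj exprMn real_normK ?num_real.
have -> : (G *m y) s 0 = ((l^-1)%:C)%C * ((U ^t*)%sesqui *m y) (p s) 0.
  rewrite !mxE mulr_sumr; apply: eq_bigr => k _.
  by rewrite GE !mxE mulrA.
apply: eq_fset_min => x; set r := (_ *m y) _ _.
(* Pulling out $\lambda_s$ exposes the ZF residual; its square is the division by $\|g_s\|^2 =
   \lambda_s^{-2}$. *)
have -> : r - (l%:C)%C * x = (l%:C)%C * (((l^-1)%:C)%C * r - x).
  by rewrite mulrBr mulrA -rmorphM /= mulfV ?gt_eqF // mul1r.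
by rewrite cmodM cmod_real exprMn real_normK ?num_real // exprVn invrK mulrC.
Qed.
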